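(* For every $t \in \mathbb{N}$ there exists $n_0(t)$ such that for all $n \geq n_0(t)$ the following holds. If $\mathcal{F} \subseteq \mathcal{M}_{2n}$ is a $t$-intersecting family, then \[|\mathcal{F}| \leq (2(n-t)-1)!!.\] Moreover, equality holds if and only if $\mathcal{F}$ is a canonically $t$-intersecting family, i.e. $\mathcal{F} = \mathcal{F}_T := \{m \in \mathcal{M}_{2n} : T \subseteq m\}$ for some set $T$ of $t$ pairwise disjoint edges of $K_{2n}$.
   Context: $K_{2n}$ is the complete graph on vertex set $[2n]=\{1,\dots,2n\}$ and $\mathcal{M}_{2n}$ is the set of all perfect matchings of $K_{2n}$ (each viewed as a set of $n$ edges). A family $\mathcal{F} \subseteq \mathcal{M}_{2n}$ is $t$-intersecting if $|m \cap m'| \geq t$ for all $m,m' \in \mathcal{F}$. For a positive integer $k$, $(2k-1)!! = 1\cdot 3 \cdot 5 \cdots (2k-1)$, and $(-1)!! = 1$. *)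

(* Defs.v *)
From mathcomp Require Import all_boot all_order.
Set Implicit Arguments. Unset Strict Implicit. Unset Printing Implicit Defensive.

Definition vertex (n : nat) := 'I_(2 * n).
Definition edge_of (n : nat) (e : {set vertex n}) : bool := #|e| == 2.

Definition perfect_matching (n : nat) (m : {set {set vertex n}}) : bool :=
  [forall e in m, edge_of e] &&
  [forall v : vertex n, #|[set e in m | v \in e]| == 1].

Definition t_intersecting (n t : nat) (F : {set {set {set vertex n}}}) : Prop :=
  forall m m', m \in F -> m' \in F -> t <= #|m :&: m'|.

(* (2k-1)!! = 1*3*...*(2k-1), with (-1)!! = 1 for k = 0. *)
Definition odd_dfact (k : nat) : nat := \prod_(i < k) (2 * i + 1).

Definition disjoint_edges (n t : nat) (T : {set {set vertex n}}) : Prop :=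
  #|T| = t /\ (forall e, e \in T -> edge_of e) /\
  (forall e f, e \in T -> f \in T -> e != f -> [disjoint e & f]).

Definition canon_family (n : nat) (T : {set {set vertex n}})
  : {set {set {set vertex n}}} :=
  [set m | perfect_matching m && (T \subset m)].

(* Main.v *)
Require Import Defs.
From mathcomp Require Import all_boot all_order.
From mathcomp Require Import zify.

(** Write [M s = (2(n-s)-1)!!], the number of perfect matchings containing [s]
    given disjoint edges, and let [q] be of order [log n]. Call a set [S] of fewer
    than [q] edges a core set if some nonempty subfamily of [F] consists of
    matchings containing [S] in which every edge outside [S] has density less
    than [1/n]. Two such subfamilies contain matchings meeting only inside the
    intersection of their core sets, by a union bound over the at most [n] edges
    of a matching; hence the core sets are themselves [t]-intersecting. The
    matchings of [F] containing no core set number at most [n^q * M q], which is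
    negligible because [M t / M q] is about [(2n)^(q-t)]. If the core sets have
    no common [t]-subset, the remaining matchings number at most
    [q^(t+1) * M (t+1)], far less than [M t]. If they have a common [t]-subset
    [T] and some [B] in [F] does not contain [T], then each matching of [F]
    containing [T] also contains an edge of [B] outside [T], so there are at most
    [n * M (t+1)] of them, about half of [M t]. *)

(** * Spread subfamilies and core sets *)

Section SetFamilies.
Variable E : finType.
Implicit Types (F G H : {set {set E}}) (S T X m : {set E}) (e : E).

Definition star F S := [set m in F | S \subset m].

Definition intersecting t F :=
  forall m m', m \in F -> m' \in F -> t <= #|m :&: m'|.

Lemma star_sub F S : star F S \subset F.
Proof. by apply/subsetP => m; rewrite inE => /andP[]. Qed.

Lemma star0 F : star F set0 = F.
Proof. by apply/setP => m; rewrite inE sub0set andbT. Qed.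

Lemma starU F S T : star F (S :|: T) = star (star F T) S.
Proof. by apply/setP => m; rewrite !inE subUset -andbA [X in _ && X]andbC. Qed.

Lemma starS F G S : F \subset G -> #|star F S| <= #|star G S|.
Proof.
move=> /subsetP sFG; apply: subset_leq_card; apply/subsetP => m.
by rewrite !inE => /andP[/sFG -> ->].
Qed.

Lemma card_cover_sum {T I : finType} (A : {set T}) (P : {set I})
    (B : I -> {set T}) :
  (forall x, x \in A -> exists2 i, i \in P & x \in B i) ->
  #|A| <= \sum_(i in P) #|B i|.
Proof.
move=> AB; apply: (@leq_trans #|\bigcup_(i in P) B i|).
  apply/subset_leq_card/subsetP => x /AB[i Pi Bi].
  by apply/bigcupP; exists i.
elim/big_rec2: _ => [|i n C _ IH]; first by rewrite cards0.
exact: leq_trans (leq_card_setU _ _) (leq_add _ IH).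
Qed.

(** If every member met [X], then [G] would be covered by the at most [n] stars of elements of [X],
    each smaller than [#|G| / n]. *)
Lemma union_bound G X n :
  G != set0 -> #|X| <= n ->
  (forall e, e \in X -> n * #|star G [set e]| < #|G|) ->
  exists2 m, m \in G & [disjoint m & X].
Proof.
move=> G0 Xn sparse.
have [/exists_inP[m mG mX]|/exists_inPn hit] :=
  boolP [exists m in G, [disjoint m & X]]; first by exists m.
have le_sum : #|G| <= \sum_(e in X) #|star G [set e]|.
  apply: card_cover_sum => m mG; have := hit m mG.
  rewrite -setI_eq0 => /set0Pn[e]; rewrite inE => /andP[em eX].
  by exists e => //; rewrite inE mG sub1set.
have G1 : 0 < #|G| by rewrite card_gt0.
have : n * #|G| <= #|X| * #|G|.-1.
  rewrite (leq_trans (leq_mul (leqnn n) le_sum)) // big_distrr /=.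
  rewrite -sum_nat_const; apply: leq_sum => e /sparse lt.
  by rewrite -ltnS (prednK G1).
have [X0|X0] := posnP #|X|.
  by move: le_sum; rewrite (cards0_eq X0) big_set0; lia.
move/leq_trans/(_ (leq_mul Xn (leqnn _))); rewrite leq_pmul2l; lia.
Qed.

Definition spread_over n S G :=
  [&& G != set0, [forall m in G, S \subset m] &
      [forall e, (e \notin S) ==> (n * #|star G [set e]| < #|G|)]].

Definition core n q F :=
  [set S : {set E} | (#|S| < q) &&
     [exists G : {set {set E}}, (G \subset F) && spread_over n S G]].

Definition rest n q F :=
  [set m in F | [forall S in core n q F, ~~ (S \subset m)]].

Lemma rest_sub n q F : rest n q F \subset F.
Proof. by apply/subsetP => m; rewrite inE => /andP[]. Qed.

Lemma restPn n q F m : m \in F -> m \notin rest n q F ->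
  exists2 S, S \in core n q F & S \subset m.
Proof.
move=> mF; rewrite inE mF /= negb_forall => /existsP[S].
by rewrite negb_imply negbK => /andP[]; exists S.
Qed.

Lemma core_member n q F S : S \in core n q F ->
  exists2 m, m \in F & S \subset m.
Proof.
rewrite inE => /andP[_ /existsP[G /and3P[/subsetP sGF /set0Pn[m mG]]]].
by case/andP=> /forall_inP/(_ m mG); exists m; rewrite ?sGF.
Qed.

(** Choose [m1] in [G1] avoiding [S2 :\: S1], and only then [m2] in [G2] avoiding [m1 :\: S2]. An
    element common to [m1] and [m2] lies in [S2] by the second choice, hence in [S1] by the
    first. *)
Lemma core_intersecting t n q F :
  (forall m, m \in F -> #|m| <= n) -> q <= n ->
  intersecting t F -> intersecting t (core n q F).
Proof.
move=> Fn qn Ft S1 S2; rewrite !inE.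
case/andP=> q1 /existsP[G1 /and4P[/subsetP F1 G10 /forall_inP S1G /forallP sp1]].
case/andP=> q2 /existsP[G2 /and4P[/subsetP F2 G20 /forall_inP S2G /forallP sp2]].
have [|e|m1 m1G d1] := @union_bound G1 (S2 :\: S1) n G10.
- by rewrite (leq_trans (subset_leq_card (subsetDl _ _))) // ltnW // (leq_trans q2).
- by rewrite inE => /andP[eS1 _]; exact: (implyP (sp1 e)).
have [|e|m2 m2G d2] := @union_bound G2 (m1 :\: S2) n G20.
- exact: leq_trans (subset_leq_card (subsetDl _ _)) (Fn _ (F1 _ m1G)).
- by rewrite inE => /andP[eS2 _]; exact: (implyP (sp2 e)).
apply: leq_trans (Ft _ _ (F1 _ m1G) (F2 _ m2G)) _.
apply/subset_leq_card/subsetP => e; rewrite !inE => /andP[e1 e2].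
have eS2 : e \in S2.
  by have := disjointFr d2 e2; rewrite inE e1 andbT => /negbFE.
by have := disjointFr d1 e1; rewrite inE eS2 andbT => /negbFE ->.
Qed.

(* A set [S] of maximal size at most [q] with [#|F'| <= n ^ #|S| * #|star F' S|],
   [F'] being the rest, would belong to the core if its size were less than [q]. *)
Lemma rest_bound n q F N :
  (forall S, #|S| = q -> #|star F S| <= N) ->
  #|rest n q F| <= n ^ q * N.
Proof.
move=> FN; set F' := rest n q F.
have [->|F'0] := eqVneq F' set0; first by rewrite cards0.
pose P S := (#|S| <= q) && (#|F'| <= n ^ #|S| * #|star F' S|).
have P0 : P set0 by rewrite /P cards0 star0 mul1n leqnn.
case: (arg_maxnP (fun S => #|S|) P0) => S /andP[Sq dS] maxS.
have [Slt|Sge] := ltnP #|S| q; last first.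
  have Seq : #|S| = q by apply/eqP; rewrite eqn_leq Sq.
  rewrite -Seq (leq_trans dS) // Seq leq_mul2l.
  by rewrite (leq_trans (starS _ _ _ (rest_sub n q F))) ?FN ?orbT.
have F'S0 : star F' S != set0.
  apply/eqP => SE; move: dS; rewrite SE cards0 muln0 leqn0 cards_eq0.
  exact/negP.
have Score : S \in core n q F.
  rewrite inE Slt; apply/existsP; exists (star F' S).
  rewrite (subset_trans (star_sub _ _) (rest_sub n q F)) /= /spread_over F'S0 /=.
  apply/andP; split; first by apply/forall_inP => m; rewrite inE => /andP[].
  apply/forallP => e; apply/implyP => eS; rewrite ltnNge -starU.
  (* An element [e] of density at least [1/n] could be added to [S] at the cost of one factor [n],
     against maximality. *)
  apply/negP => ge; have := maxS (e |: S).
  rewrite /P cardsU1 eS add1n Slt expnSr -mulnA.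
  by rewrite (leq_trans dS) ?leq_mul2l ?ge ?orbT // => /(_ isT); rewrite /= ltnn.
have /set0Pn[m] := F'S0; rewrite !inE => /andP[/andP[_ /forall_inP mS] Sm].
by have := mS _ Score; rewrite Sm.
Qed.

Lemma bin_leq_expn a b : 'C(a, b) <= a ^ b.
Proof.
elim: a b => [[]//|a IH] [|b]; first by rewrite bin0.
rewrite binS (leq_trans (leq_add (IH _) (IH _))) // expnS addnC -mulSn.
by rewrite expnS leq_mul2l; case: b => // b; rewrite leq_exp2r // leqnSn orbT.
Qed.

(** Fix [S1] in [C]. Each [m] in [H] contains some [S] in [C], hence a [t]-set [T] inside
    [S1 :&: S]. If some [avoid T] in [C] does not contain [T], its intersection with [S] has at
    least [t] elements and is not inside [T], so [m] contains a further element of [avoid T]. There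
    are at most [q ^ t] choices of [T] and [q] of that element. *)
Lemma intersecting_kernel t q N (C : {set {set E}}) H :
  (forall S, S \in C -> #|S| <= q) -> intersecting t C ->
  (forall m, m \in H -> exists2 S, S \in C & S \subset m) ->
  (forall X, #|X| = t.+1 -> #|star H X| <= N) ->
  (exists T, #|T| = t /\ forall S, S \in C -> T \subset S) \/
  #|H| <= q ^ t.+1 * N.
Proof.
move=> Cq Ct HC HN.
have [/existsP[T /andP[/eqP Tt /forall_inP TC]]|/existsPn noT] :=
  boolP [exists T : {set E}, (#|T| == t) && [forall S in C, T \subset S]].
  by left; exists T.
right; have [->|/set0Pn[m0 m0H]] := eqVneq H set0; first by rewrite cards0.
have [S1 S1C _] := HC _ m0H.
pose P := [set T : {set E} | T \subset S1 & #|T| == t].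
(* The default [S1] only makes [avoid] total: by [noT], the pick succeeds whenever [#|T| = t]. *)
pose avoid T := odflt S1 [pick S in C | ~~ (T \subset S)].
have avoidP T : #|T| = t -> avoid T \in C /\ ~~ (T \subset avoid T).
  move=> Tt; rewrite /avoid; case: pickP => [S /andP[//]|none].
  have := noT T; rewrite Tt eqxx /= negb_forall => /existsP[S].
  by rewrite negb_imply; have := none S => /= ->.
have sumP : #|H| <= \sum_(T in P) \sum_(e in avoid T :\: T) #|star H (e |: T)|.
  apply: leq_trans (_ : _ <= \sum_(T in P) #|[set m in H |
     [exists e in avoid T :\: T, e |: T \subset m]]|) _.
    apply: card_cover_sum => m mH; have [S SC Sm] := HC m mH.
    have : 0 < #|[set T : {set E} | T \subset S1 :&: S & #|T| == t]|.
      by rewrite cards_draws bin_gt0 Ct.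
    rewrite card_gt0 => /set0Pn[T]; rewrite inE subsetI.
    move=> /andP[/andP[TS1 TS] /eqP Tt].
    exists T; first by rewrite inE TS1 Tt eqxx.
    rewrite inE mH /=.
    have [aC aT] := avoidP T Tt.
    have /subsetPn[e] : ~~ (avoid T :&: S \subset T).
      apply: contra aT => sub.
      suff {1}-> : T = avoid T :&: S by exact: subsetIl.
      by apply/esym/eqP; rewrite eqEcard sub Tt Ct.
    rewrite inE => /andP[ea eS] eT.
    apply/exists_inP; exists e; first by rewrite inE eT.
    by rewrite subUset sub1set (subsetP Sm _ eS) (subset_trans TS Sm).
  apply: leq_sum => T _; apply: card_cover_sum => m; rewrite inE.
  by case/andP=> mH /exists_inP[e ea em]; exists e; rewrite // inE mH.
apply: (leq_trans sumP).
apply: (@leq_trans (\sum_(T in P) q * N)).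
  apply: leq_sum => T; rewrite inE => /andP[_ /eqP Tt].
  apply: (@leq_trans (\sum_(e in avoid T :\: T) N)).
    apply: leq_sum => e; rewrite inE => /andP[eT _].
    by rewrite HN // cardsU1 eT Tt.
  rewrite sum_nat_const leq_mul2r (leq_trans (subset_leq_card (subsetDl _ _))) ?orbT //.
  by apply: Cq; case: (avoidP T Tt).
rewrite sum_nat_const mulnA leq_mul2r expnSr leq_mul2r cards_draws.
rewrite (leq_trans (bin_leq_expn _ _)) ?orbT //.
by case: (t) => // t'; rewrite leq_exp2r // Cq.
Qed.

End SetFamilies.

Arguments star {E} F S.
Arguments intersecting {E} t F.
Arguments core {E} n q F.
Arguments rest {E} n q F.

(** * Double factorials and the number of perfect matchings *)

Lemma odd_dfactS k : odd_dfact k.+1 = (2 * k + 1) * odd_dfact k.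
Proof. by rewrite /odd_dfact big_ord_recr /= mulnC. Qed.

Lemma odd_dfact_gt0 k : 0 < odd_dfact k.
Proof. by apply: prodn_gt0 => i; rewrite addn1. Qed.

Lemma odd_dfact_grow k d : (2 * k) ^ d * odd_dfact k <= odd_dfact (k + d).
Proof.
elim: d => [|d IH]; first by rewrite mul1n addn0.
by rewrite addnS odd_dfactS expnS -mulnA leq_mul //; lia.
Qed.

Section Matchings.
Variable V : finType.
Implicit Types (U : {set V}) (m T : {set {set V}}).

(** An arbitrary vertex set [U] allows induction on vertices and deletion of edges. In this form,
    [T] consists of disjoint edges exactly when [T \in matchings (cover T)]. *)
Definition matchings U :=
  [set m : {set {set V}} |
    [&& cover m == U, trivIset m & [forall e in m, #|e| == 2]]].

Lemma card_matching U m : m \in matchings U -> #|U| = 2 * #|m|.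
Proof.
rewrite inE => /and3P[/eqP <- /eqP <- /forall_inP m2].
by rewrite (eq_bigr (fun=> 2)) ?sum_nat_const 1?mulnC // => e /m2/eqP.
Qed.

Lemma matchingS U m T : m \in matchings U -> T \subset m ->
  T \in matchings (cover T).
Proof.
rewrite !inE eqxx => /and3P[_ tI /forall_inP m2] Tm.
rewrite (trivIsetS Tm tI); apply/forall_inP => e /(subsetP Tm); exact: m2.
Qed.

Lemma matchingU U1 U2 m1 m2 : [disjoint U1 & U2] ->
  m1 \in matchings U1 -> m2 \in matchings U2 -> m1 :|: m2 \in matchings (U1 :|: U2).
Proof.
rewrite !inE => dU /and3P[/eqP c1 t1 /forall_inP e1] /and3P[/eqP c2 t2 /forall_inP e2].
rewrite trivIsetU ?c1 ?c2 // /cover bigcup_setU -!/(cover _) c1 c2 eqxx /=.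
by apply/forall_inP => e; rewrite inE => /orP[/e1|/e2].
Qed.

Lemma matchingD U m T : m \in matchings U -> T \subset m ->
  m :\: T \in matchings (U :\: cover T).
Proof.
move=> mU Tm; have /[!inE] := mU => /and3P[/eqP cm tI _].
have := matchingS _ _ _ mU (subsetDl m T); rewrite !inE eqxx /= => /andP[-> ->].
rewrite !andbT eqEsubset; apply/andP; split; apply/subsetP => v.
  case/bigcupP=> e; rewrite inE => /andP[eT em] ve.
  rewrite inE -cm; apply/andP; split; last by apply/bigcupP; exists e.
  apply/bigcupP => -[f fT vf]; move/trivIsetP: tI => /(_ e f em (subsetP Tm _ fT)).
  case: eqP => [ef|_ /(_ isT) /disjointFr/(_ ve)]; last by rewrite vf.
  by rewrite ef fT in eT.
rewrite inE -cm => /andP[vT /bigcupP[e em ve]].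
apply/bigcupP; exists e => //; rewrite inE em andbT.
by apply: contra vT => eT; apply/bigcupP; exists e.
Qed.

Lemma matching_disjoint U1 U2 m1 m2 : [disjoint U1 & U2] ->
  m1 \in matchings U1 -> m2 \in matchings U2 -> [disjoint m1 & m2].
Proof.
move=> dU; rewrite !inE => /and3P[/eqP c1 _ /forall_inP e1] /and3P[/eqP c2 _ _].
rewrite -setI_eq0; apply/set0Pn => -[e]; rewrite inE => /andP[em1 em2].
have /card_gt0P[v ve] : 0 < #|e| by rewrite (eqP (e1 _ em1)).
have v1 : v \in U1 by rewrite -c1; apply/bigcupP; exists e.
have v2 : v \in U2 by rewrite -c2; apply/bigcupP; exists e.
by rewrite (disjointFr dU v1) in v2.
Qed.

(** Deleting [T] is a bijection, with inverse the union with [T]. *)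
Lemma card_star_matchings_cover U T :
  T \in matchings (cover T) -> cover T \subset U ->
  #|star (matchings U) T| = #|matchings (U :\: cover T)|.
Proof.
move=> TM TU.
have dU : [disjoint U :\: cover T & cover T].
  by rewrite disjoints_subset subsetDr.
have UE : U :\: cover T :|: cover T = U by rewrite setUC -{1}(setIidPr TU) setID.
have <- : [set m :\: T | m in star (matchings U) T] = matchings (U :\: cover T).
  apply/setP => m; apply/imsetP/idP => [[m'] | mM].
    by rewrite inE => /andP[m'U Tm'] ->; exact: matchingD.
  exists (m :|: T); last first.
    rewrite setDUl setDv setU0; apply/esym/setDidPl.
    exact: matching_disjoint dU mM TM.
  by rewrite inE subsetUr -{1}UE (matchingU _ _ _ _ dU mM TM).
rewrite card_in_imset // => m1 m2; rewrite !inE.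
move=> /andP[_ s1] /andP[_ s2] eqD.
by rewrite -(setID m1 T) -(setID m2 T) eqD (setIidPr s1) (setIidPr s2).
Qed.

Lemma matching1 (x y : V) : x != y -> [set [set x; y]] \in matchings [set x; y].
Proof.
move=> xy; rewrite inE /cover big_set1 eqxx /=; apply/andP; split.
  by apply/trivIsetP => A B /set1P-> /set1P->; rewrite eqxx.
by apply/forall_inP => e /set1P->; rewrite cards2 xy.
Qed.

(** Sort the matchings by the partner [y] of a fixed vertex [x]. *)
Lemma card_matchings k U : #|U| = 2 * k -> #|matchings U| = odd_dfact k.
Proof.
elim: k U => [|k IH] U Uk.
  have -> : U = set0 by apply/cards0_eq; rewrite Uk.
  rewrite /odd_dfact big_ord0.
  suff -> : matchings set0 = [set set0] by rewrite cards1.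
  apply/setP => m; rewrite in_set1; apply/idP/eqP => [/card_matching|->].
    by rewrite cards0 => /esym/eqP; rewrite muln_eq0 /= cards_eq0 => /eqP.
  rewrite inE /cover big_set0 eqxx /=; apply/andP; split.
    by apply/trivIsetP => A B; rewrite inE.
  by apply/forall_inP => e; rewrite inE.
have /card_gt0P[x xU] : 0 < #|U| by rewrite Uk mulnS.
have count_xy y : y \in U :\ x ->
    #|star (matchings U) [set [set x; y]]| = odd_dfact k.
  rewrite !inE => /andP[yx yU].
  have xyU : [set x; y] \subset U by rewrite subUset !sub1set xU.
  have cov : cover [set [set x; y]] = [set x; y] by rewrite /cover big_set1.
  rewrite card_star_matchings_cover ?cov ?matching1 1?eq_sym //; apply: IH.
  by rewrite cardsDS // Uk cards2 eq_sym yx mulnS addKn.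
have -> : #|matchings U| =
    \sum_(y in U :\ x) #|star (matchings U) [set [set x; y]]|.
  rewrite -sum1_card.
  rewrite (eq_bigr (fun y => \sum_(m in matchings U) ([set x; y] \in m))); last first.
    move=> y _; rewrite -sum1_card big_mkcond [RHS]big_mkcond; apply: eq_bigr => m _.
    by rewrite inE sub1set; case: (m \in _) => //=; case: (_ \in _).
  (* After the exchange, each matching must be counted once: exactly one [y] has [[set x; y]] in
     [m]. *)
  rewrite exchange_big; apply: eq_bigr => m mM /=.
  have /[!inE] := mM => /and3P[/eqP cm tI /forall_inP m2].
  have /bigcupP[e em xe] : x \in cover m by rewrite cm.
  have [y eE yx] : exists2 y, e = [set x; y] & y != x.
    have /cards1P[y ey] : #|e :\ x| == 1.
      by have := m2 _ em; rewrite (cardsD1 x) xe eqSS.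
    exists y; last by have := set11 y; rewrite -ey !inE => /andP[].
    by rewrite -(setD1K xe) ey.
  have yU : y \in U :\ x.
    rewrite !inE yx -cm; apply/bigcupP; exists e => //.
    by rewrite eE set22.
  rewrite (bigD1 y) //= -eE em big1 // => z /andP[]; rewrite !inE => /andP[zx _] zy.
  apply/eqP; rewrite eqb0; apply/negP => fm; move/trivIsetP: tI => /(_ _ _ em fm).
  case: eqP => [ef _|_ /(_ isT)/disjointFr/(_ xe)]; last by rewrite set21.
  have : z \in e by rewrite ef set22.
  by rewrite eE !inE (negPf zx) (negPf zy).
rewrite (eq_bigr _ count_xy) sum_nat_const odd_dfactS; congr (_ * _).
by have := cardsD1 x U; rewrite xU Uk; lia.
Qed.

Lemma card_star_matching n T : #|V| = 2 * n -> T \in matchings (cover T) ->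
  #|star (matchings setT) T| = odd_dfact (n - #|T|).
Proof.
move=> Vn TM; rewrite card_star_matchings_cover ?subsetT //; apply: card_matchings.
by rewrite cardsDS ?subsetT // cardsT Vn (card_matching _ _ TM) mulnBr.
Qed.

(** For arbitrary [T]: unless its members are disjoint edges, the star is empty. *)
Lemma card_star_matching_le n T : #|V| = 2 * n ->
  #|star (matchings setT) T| <= odd_dfact (n - #|T|).
Proof.
move=> Vn; have [->|/set0Pn[m]] := eqVneq (star (matchings setT) T) set0.
  by rewrite cards0.
rewrite inE => /andP[mM Tm].
by rewrite (card_star_matching n) // (matchingS _ _ _ mM).
Qed.

End Matchings.

Arguments matchings {V} U.

(** * The choice of the cutoff [q] *)

Lemma linear_expn_le_exp2 a d :
  0 < d -> exists l0, forall l, l0 <= l -> (a * l.+1) ^ d <= 2 ^ l.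
Proof.
move=> d0; exists (2 * d * (2 * a * d)) => l ll0.
set h := l %/ (2 * d).
have hl : h * (2 * d) <= l by apply: leq_divM.
have lh : l < h.+1 * (2 * d) by rewrite ltn_ceil ?muln_gt0.
have h0 : 2 * a * d <= h by rewrite leq_divRL ?muln_gt0 // mulnC.
apply: (@leq_trans ((2 ^ (2 * h)) ^ d)); last first.
  by rewrite -expnM leq_exp2l // (leq_trans _ hl) //; lia.
rewrite leq_exp2r // mul2n -addnn expnD.
have h2 : h < 2 ^ h by apply: ltn_expl.
apply: leq_trans (leq_mul (leq_trans h0 (ltnW h2)) h2); nia.
Qed.

(* [q - t] is of order [t * log n], so that [(3/2)^(q-t)] beats [8 * n^t]. *)
Lemma cutoff_exists t : exists n0, forall n, n0 <= n -> exists q,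
  [/\ t < q, 16 * q ^ t.+1 <= n & 8 * n ^ t * 2 ^ (q - t) <= 3 ^ (q - t)].
Proof.
have [l0 Hl0] := linear_expn_le_exp2 (3 * t + 6) (t + 6) ltac:(lia).
exists (2 ^ l0).+2 => n nn0; set l := up_log 2 n.
have n1 : 1 < n by lia.
have nl : n <= 2 ^ l by apply: up_logP.
have l_gt0 : 0 < l by rewrite up_log_gt0.
have ln : 2 ^ l < 2 * n.
  by have := up_log_gtn (isT : 1 < 2) n1; rewrite -/l -{2}(prednK l_gt0) expnS; lia.
have l0l : l0 <= l by rewrite -(@leq_exp2l 2) //; lia.
(* With [q - t = 2 * x], the last condition becomes [8 * n ^ t * 4 ^ x <= 9 ^ x]; it holds because
   [8 * n ^ t <= 2 ^ x] and [8 ^ x <= 9 ^ x]. *)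
exists (t + 2 * (l * t + 3)); rewrite addKn.
set x := l * t + 3; set q := t + _.
have xE : 2 ^ x = 8 * (2 ^ l) ^ t.
  by rewrite /x expnD mulnC expnM (_ : 2 ^ 3 = 8).
split; [by rewrite /q; lia| |].
- have bound := Hl0 l l0l; set y := (3 * t + 6) * l.+1 in bound.
  have qy : q <= y by rewrite /q /y; nia.
  have y2 : 2 <= y by rewrite /y; nia.
  have qyt : q ^ t.+1 <= y ^ t.+1 by rewrite leq_exp2r.
  (* Five spare powers of [y] absorb the constant 32, which [2 ^ l < 2 * n] turns into the required
     16. *)
  have : 2 ^ 5 * y ^ t.+1 <= y ^ 5 * y ^ t.+1 by rewrite leq_mul2r leq_exp2r ?y2 ?orbT.
  rewrite -expnD (_ : 5 + t.+1 = t + 6); last by lia.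
  rewrite (_ : 2 ^ 5 = 32) //; lia.
rewrite !expnM; apply: (@leq_trans (8 ^ x)); last first.
  by case: (x) => // x'; rewrite leq_exp2r.
rewrite (_ : 8 = 2 * (2 ^ 2)) // expnMn leq_mul2r; apply/orP; right.
rewrite xE leq_mul2l; case: (t) => // t'; by rewrite leq_exp2r ?nl.
Qed.

(** * Translation to perfect matchings of the complete graph *)

(** At least one edge at each vertex amounts to covering, at most one to disjointness. *)
Lemma perfect_matchingE n (m : {set {set vertex n}}) :
  perfect_matching m = (m \in matchings setT).
Proof.
rewrite inE andbCA andbA andbC /perfect_matching; congr (_ && _).
apply/forallP/andP => [m1|[/trivIsetP tI /eqP cm] v].
  split; last first.
    rewrite eqEsubset subsetT; apply/subsetP => v _.
    have /cards1P[e /setP/(_ e)] := m1 v.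
    by rewrite !inE eqxx => /andP[em ve]; apply/bigcupP; exists e.
  apply/trivIsetP => e f em fm; apply: contraNT => /pred0Pn[v /andP[/= ve vf]].
  have /cards1P[g mg] := m1 v.
  have : e \in [set g] by rewrite -mg inE em.
  have : f \in [set g] by rewrite -mg inE fm.
  by move=> /set1P-> /set1P->.
have /bigcupP[e em ve] : v \in cover m by rewrite cm inE.
apply/cards1P; exists e; apply/setP => f; rewrite !inE.
apply/andP/eqP => [[fm vf]|->//]; apply/eqP; apply: contraTT vf => fe.
by rewrite (disjointFl (tI f e fm em fe) ve).
Qed.

Lemma canon_familyE n (T : {set {set vertex n}}) :
  canon_family T = star (matchings setT) T.
Proof. by apply/setP => m; rewrite [RHS]inE inE perfect_matchingE. Qed.

Lemma disjoint_edgesP n t (T : {set {set vertex n}}) :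
  disjoint_edges t T <-> #|T| = t /\ T \in matchings (cover T).
Proof.
rewrite inE eqxx /=; split=> [[Tt [T2 Td]]|[Tt /andP[/trivIsetP Td /forall_inP T2]]].
  by split=> //; apply/andP; split; [apply/trivIsetP|apply/forall_inP].
by split=> //; split=> // e f; apply: Td.
Qed.

Lemma card_canon_family n t (T : {set {set vertex n}}) :
  disjoint_edges t T -> #|canon_family T| = odd_dfact (n - t).
Proof.
case/disjoint_edgesP=> <- TM.
by rewrite canon_familyE (card_star_matching _ n) // card_ord.
Qed.

(** * The dichotomy for large [n] *)

Section Bound.
Variables n t q : nat.
Variable F : {set {set {set vertex n}}}.
Hypothesis FM : F \subset matchings setT.
Hypothesis Ft : intersecting t F.
Hypothesis tq : t < q.
Hypothesis qn : 16 * q ^ t.+1 <= n.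
Hypothesis qlog : 8 * n ^ t * 2 ^ (q - t) <= 3 ^ (q - t).

Let M s := odd_dfact (n - s).

Lemma q_le : 16 * q <= n.
Proof.
apply: leq_trans qn; rewrite leq_mul2l /= -{1}(expn1 q) leq_pexp2l //.
exact: leq_trans tq.
Qed.

Lemma star_le S : #|star F S| <= M #|S|.
Proof.
by rewrite (leq_trans (starS _ _ _ _ FM)) // (card_star_matching_le _ n) // card_ord.
Qed.

Lemma card_member m : m \in F -> #|m| = n.
Proof.
move=> /(subsetP FM) /card_matching; rewrite cardsT card_ord; lia.
Qed.

Lemma M_step : M t = (2 * (n - t.+1) + 1) * M t.+1.
Proof. by rewrite /M -odd_dfactS; congr odd_dfact; have := q_le; lia. Qed.

Lemma rest_small : 8 * #|rest n q F| <= M t.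
Proof.
have q16 := q_le.
apply: (@leq_trans (8 * (n ^ q * M q))).
  by rewrite leq_mul2l rest_bound // => S <-; exact: star_le.
have grow : (2 * (n - q)) ^ (q - t) * M q <= M t.
  rewrite /M (_ : n - t = n - q + (q - t)) ?odd_dfact_grow //; lia.
apply: leq_trans grow; rewrite mulnA leq_mul2r; apply/orP; right.
(* This clears the denominator of [3/2]: [16 * q <= n] gives [3 * n <= 2 * (2 * (n - q))]. *)
rewrite -(@leq_pmul2l (2 ^ (q - t))) ?expn_gt0 // -expnMn.
apply: (@leq_trans ((3 * n) ^ (q - t))); last first.
  by rewrite leq_exp2r ?subn_gt0 //; lia.
have -> : n ^ q = n ^ t * n ^ (q - t) by rewrite -expnD subnKC // ltnW.
rewrite expnMn mulnC !mulnA -[_ * 2 ^ _]mulnAC.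
by rewrite leq_mul2r qlog orbT.
Qed.

(** Strictness on the left is what settles the equality case: a family of size [M t] must lie in a
    canonical family, which has the same size. *)
Lemma bound_or_sub : #|F| < M t \/
  exists T, disjoint_edges t T /\ F \subset canon_family T.
Proof.
have q16 := q_le; have small := rest_small; have step := M_step.
have M1 : 0 < M t.+1 by apply: odd_dfact_gt0.
set R := rest n q F in small.
have splitF (H : {set {set {set vertex n}}}) :
    H \subset F -> F :\: H \subset R -> #|F| <= #|H| + #|R|.
  move=> HF /subset_leq_card; rewrite cardsDS //; lia.
have FRH : F :\: (F :\: R) \subset R.
  by rewrite setDDr setDv set0U subsetIr.
have Ct : intersecting t (core n q F).
  by apply: core_intersecting => [m /card_member->//||//]; lia.
have [||m|X Xt|[T [Tt TC]]|big] :=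
  @intersecting_kernel _ t q (M t.+1) (core n q F) (F :\: R).
- by move=> S; rewrite inE => /andP[/ltnW].
- exact: Ct.
- by rewrite inE => /andP[mR mF]; exact: restPn mF mR.
- by rewrite -Xt (leq_trans (starS _ _ _ _ (subsetDl F R))) // star_le.
(* With no core set, [T] is arbitrary and need not consist of disjoint edges; but then all of [F] is
   in the rest. *)
- have [C0|/set0Pn[S0 S0C]] := eqVneq (core n q F) set0.
    left; have : #|F| <= #|F :\: R| + #|R| by apply: splitF; rewrite ?subsetDl.
    suff -> : F :\: R = set0 by rewrite cards0; nia.
    apply/setP => m; rewrite in_set0; apply/negP; rewrite inE => /andP[mR mF].
    by have [S] := restPn _ _ _ _ _ mF mR; rewrite C0 inE.
  have [m0 m0F S0m] := core_member _ _ _ _ _ S0C.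
  have TM : T \in matchings (cover T).
    by apply: matchingS (subsetP FM _ m0F) (subset_trans (TC _ S0C) S0m).
  have [sub|/subsetPn[B BF BT]] := boolP (F \subset canon_family T).
    by right; exists T; split=> //; apply/disjoint_edgesP.
  left; rewrite canon_familyE inE (subsetP FM) //= in BT.
  have FT : F :\: star F T \subset R.
    apply/subsetP => m; rewrite !inE => /andP[+ mF]; rewrite mF /= => mT.
    apply/forall_inP => S SC; apply: contra mT; exact: subset_trans (TC _ SC).
  have le1 : #|F| <= #|star F T| + #|R| by apply: splitF; rewrite ?star_sub.
  have le2 : #|star F T| <= n * M t.+1.
    apply: (@leq_trans (\sum_(e in B :\: T) #|star F (e |: T)|)).
      apply: card_cover_sum => m; rewrite inE => /andP[mF Tm].
      have /subsetPn[e] : ~~ (m :&: B \subset T).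
        apply: contra BT => sub; suff -> : T = m :&: B by exact: subsetIr.
        by apply/esym/eqP; rewrite eqEcard sub Tt Ft.
      rewrite inE => /andP[em eB] eT; exists e; first by rewrite inE eT.
      by rewrite inE mF subUset sub1set em.
    apply: (@leq_trans (\sum_(e in B :\: T) M t.+1)).
      apply: leq_sum => e; rewrite inE => /andP[eT _].
      by rewrite (leq_trans (star_le _)) // cardsU1 eT Tt.
    rewrite sum_nat_const leq_mul2r; apply/orP; right.
    by rewrite -[leqRHS](card_member _ BF) subset_leq_card ?subsetDl.
  (* [n * M t.+1] plus an eighth of [M t] stays below [M t], since [M t] is [2 * (n - t.+1) + 1]
     times [M t.+1] and [16 * t.+1 <= n]. *)
  nia.
- left.
  have : #|F| <= #|F :\: R| + #|R| by apply: splitF; rewrite ?subsetDl.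
  have : 16 * q ^ t.+1 * M t.+1 <= n * M t.+1 by rewrite leq_mul2r qn orbT.
  nia.
Qed.

End Bound.

Theorem mainTheorem1 (t : nat) :
  exists n0 : nat, forall n : nat, n0 <= n ->
    forall F : {set {set {set vertex n}}},
      (forall m, m \in F -> perfect_matching m) ->
      t_intersecting t F ->
      #|F| <= odd_dfact (n - t) /\
      (#|F| = odd_dfact (n - t) <->
         exists T : {set {set vertex n}}, disjoint_edges t T /\ F = canon_family T).
Proof.
have [n0 Hn0] := cutoff_exists t.
exists n0 => n /Hn0[q [tq qn qlog]] F Fpm Ft.
have FM : F \subset matchings setT.
  by apply/subsetP => m /Fpm; rewrite perfect_matchingE.
have [lt|[T [Td FT]]] := bound_or_sub n t q F FM Ft tq qn qlog.
  split; first exact: ltnW.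
  split=> [eqF|[T [Td FE]]]; first by rewrite eqF ltnn in lt.
  by rewrite FE; exact: card_canon_family.
split; first by rewrite -(card_canon_family _ _ T Td) subset_leq_card.
split=> [eqF|[T' [Td' ->]]]; last exact: card_canon_family.
by exists T; split=> //; apply/eqP; rewrite eqEcard FT eqF (card_canon_family _ _ T Td) /=.
Qed.
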